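(* Let $p$ be a nonconstant real polynomial all of whose (complex) zeroes are simple, and for $\sigma\in\mathbb{R}$ put $p_\sigma(z)=p'(z)+\sigma p(z)$. Let $M$ be the set (depending only on $p$, not on $\sigma$) of all $\lambda\in\mathbb{C}$ for which there exists $\sigma\in\mathbb{R}$ such that $\lambda$ is a multiple zero of $p_\sigma$. Then $M$ is finite and has at most $2\deg p-2$ elements. Moreover, the number of real elements of $M$ is at most $Z_{\mathbb{C}}(p)$.
   Context: $Z_{\mathbb{C}}(p)$ denotes the number of non-real zeroes of $p$. A multiple zero is a zero of multiplicity at least $2$. A real polynomial is a polynomial with real coefficients. *)

(* Defs.v *)
From HB Require Import structures.
From mathcomp Require Import all_boot all_order all_algebra.
From mathcomp Require Import complex.
From mathcomp Require Import boolp classical_sets cardinality reals.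

Set Implicit Arguments.
Unset Strict Implicit.
Unset Printing Implicit Defensive.

Import Order.TTheory GRing.Theory Num.Theory.
Local Open Scope ring_scope.
Local Open Scope classical_set_scope.

Definition cpoly (R : realType) (p : {poly R}) : {poly R[i]} :=
  map_poly (real_complex R) p.

Definition simple_zero (C : fieldType) (q : {poly C}) (z : C) : Prop :=
  mup z q = 1%N.

(* [mup z 0 = 0], so the zero polynomial has no multiple zero here. *)
Definition multiple_zero (C : fieldType) (q : {poly C}) (z : C) : Prop :=
  (2 <= mup z q)%N.

(* Zeroes are counted with multiplicity: [closed_field_poly_normal] yields the
   list [r] such that [q = lead_coef q *: \prod_(z <- r) ('X - z%:P)]. *)
Definition ZC (R : realType) (p : {poly R}) : nat :=
  count (fun z : R[i] => z \isn't Num.real)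
    (sval (closed_field_poly_normal (cpoly p))).

Definition psigma (R : realType) (p : {poly R}) (sigma : R) : {poly R} :=
  p^`() + sigma *: p.

Definition multiple_zeros_psigma (R : realType) (p : {poly R}) : set R[i] :=
  [set lambda | exists sigma : R, multiple_zero (cpoly (psigma p sigma)) lambda].

(* Main.v *)
Require Import Defs.
From mathcomp Require Import all_boot all_order all_algebra.
From mathcomp Require Import finmap complex polyorder polyrcf.
From mathcomp Require Import boolp classical_sets cardinality reals.
From mathcomp Require Import ring lra zify.

(** If [lambda] is a multiple zero of [p' + sigma p] and the zeroes of [p] are
    simple, then [p lambda != 0] and [lambda] is a zero of
    [W p = p p'' - p' ^ 2 = p ^ 2 (p' / p)'], a polynomial of degree
    [2 deg p - 2] ([wronsk_size]).  This gives finiteness and the first bound.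
    The second bound says that [p' / p] has at most as many distinct real
    critical points as [p] has non-real zeroes ([crit_count_le_ZC]); it is
    proved for every nonconstant real [p], multiple zeroes allowed, by
    induction on the number [ZC p] of non-real zeroes.

    Suppose that [p' / p] has a real critical point.  Let [s] be the largest
    value of [- p' / p] at such points, and let [P = p' + s p], so that
    [P / p = p' / p + s] is nonnegative at all of them and vanishes at one of
    them at least.  Call events the real zeroes of [p] and the real critical
    points of [p' / p] at which [P] does not vanish.  Every event is matched
    injectively with a real zero of [P] that is not a zero of [p], or with a
    real critical point of [P' / P]; one event may be left over when
    [deg P = deg p - 1].  The facts behind the matching are:
    - just left of a zero of [p] the quotient [P / p] is negative; since it is
      positive just right of the zeroes of [p] and nonnegative at the critical
      points of [p' / p], the first zero of [P p (W p)] further left, if any,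
      is a zero of [P] and not of [p] ([exists_pole]);
    - [p (W P) = s (W p) P + (W p)' P - (W p) P'] ([wronsk_step]), so that the
      product [(W p) (W P)] is negative just left of a critical point where
      [P / p > 0] and positive just right of it.  As [W P < 0] near the zeroes
      of [P], the intermediate value theorem gives a zero of [W P] to the left
      of such a critical point, unless [W p > 0] all the way down to a zero of
      [P], which is then the match ([exists_crit]).

    On the other hand, a zero of [p] of multiplicity [m] is a zero of [P] of
    multiplicity at least [m - 1], and a common zero of [P] and [W p] outside
    the zeroes of [p] is a multiple zero of [P] ([mup_step]).  Comparing the
    two counts, the number of real critical points drops, from [p] to [P], by
    at most [ZC p - ZC P].  Restricting the matching to the zeroes of [p] shows
    that [ZC P < ZC p], and the induction goes through. *)

Set Implicit Arguments.
Unset Strict Implicit.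
Unset Printing Implicit Defensive.

Import Order.TTheory GRing.Theory Num.Theory.
Local Open Scope ring_scope.

(** * Multiplicities and logarithmic derivatives *)

Lemma mup_ge2P (F : fieldType) (q : {poly F}) x :
  (2 <= mup x q)%N = [&& q != 0, root q x & root q^`() x].
Proof.
have [->|q0] := eqVneq q 0.
  apply/negbTE; rewrite -ltnNge.
  have : (mup x (0%R : {poly F}) < (size (0%R : {poly F})).+1)%N := ltn_ord _.
  by rewrite size_poly0; case: mup.
have [qx|qx] := boolP (root q x); last by rewrite mupNroot.
move: qx; rewrite mup_geq // -dvdp_XsubCl => /dvdpP[r ->].
rewrite derivM derivXsubC mulr1 [in RHS]/root hornerD hornerM hornerXsubC subrr mulr0 add0r.
by rewrite -/(root r x) -dvdp_XsubCl expr2 dvdp_mul2r // polyXsubC_eq0.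
Qed.

Definition horner_rules := (hornerXsubC, hornerD, hornerN, hornerMn, hornerM,
  hornerZ, horner_exp, hornerC).

(** The numerator [p p'' - p' ^ 2] of [(p' / p)' = wronsk p / p ^ 2]; it is the
    Wronskian of [p] and [p']. *)
Definition wronsk (R : nzRingType) (p : {poly R}) : {poly R} :=
  p * p^`()^`() - p^`() ^+ 2.

Section Rcf.
Variable R : rcfType.
Implicit Types (p F : {poly R}) (x y a b : R).

Lemma poly_pos_near F a : 0 < F.[a] ->
  exists2 d, 0 < d & forall y, `|y - a| < d -> 0 < F.[y].
Proof.
move=> Fa; have [d d0 dP] := poly_cont a F Fa.
exists d => // y /dP; rewrite ltr_norml => /andP[+ _]; lra.
Qed.

(** Near a zero [a] of [F] the logarithmic derivative [F' / F] is unbounded and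
    has the sign of [y - a]; so has [F' / F + T / U]. *)
Lemma logder_near F U T a : F != 0 -> root F a -> 0 < U.[a] ->
  exists2 d, 0 < d & forall y, y != a -> `|y - a| < d ->
    0 < (y - a) * (F.[y] * (F^`().[y] * U.[y] + F.[y] * T.[y])).
Proof.
move=> F0 Fa Ua; have [[|k] [q]] := multiplicity_XsubC F a; rewrite F0 /=.
  by move=> qa FE; move: Fa; rewrite FE mulr1 (negPf qa).
move=> qa FE.
pose H : {poly R} := k.+1%:R *: (q ^+ 2 * U) + ('X - a%:P) * (q * q^`() * U + q ^+ 2 * T).
have Ha : 0 < H.[a].
  have -> : H.[a] = k.+1%:R * (q.[a] ^+ 2 * U.[a]).
    by rewrite /H !horner_rules subrr; ring.
  by rewrite mulr_gt0 ?ltr0n // mulr_gt0 // exprn_even_gt0.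
have [d d0 dP] := poly_pos_near Ha; exists d => // y ya /dP Hy.
have -> : (y - a) * (F.[y] * (F^`().[y] * U.[y] + F.[y] * T.[y])) =
   ((y - a) ^+ k.+1) ^+ 2 * H.[y].
  rewrite FE derivM deriv_exp derivXsubC /H mul1r !horner_rules exprS.
  by rewrite -[_ *+ k.+1]mulr_natl; ring.
by rewrite mulr_gt0 // exprn_even_gt0 //= expf_neq0 // subr_eq0.
Qed.

Lemma logder_right F U T a b : F != 0 -> root F a -> 0 < U.[a] -> a < b ->
  exists2 y, a < y < b & 0 < F.[y] * (F^`().[y] * U.[y] + F.[y] * T.[y]).
Proof.
move=> F0 Fa Ua ab; have [d d0 dP] := logder_near T F0 Fa Ua.
pose h := Num.min (d / 2) ((b - a) / 2).
have h0 : 0 < h by rewrite lt_min; apply/andP; split; lra.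
have hd : h <= d / 2 by rewrite ge_min lexx.
have hb : h <= (b - a) / 2 by rewrite ge_min lexx orbT.
exists (a + h); first by lra.
have := dP (a + h); rewrite addrAC subrr add0r gtr0_norm // pmulr_rgt0 //.
by apply; [rewrite gt_eqF //|]; lra.
Qed.

Lemma logder_left F U T a b : F != 0 -> root F a -> 0 < U.[a] -> b < a ->
  exists2 y, b < y < a & F.[y] * (F^`().[y] * U.[y] + F.[y] * T.[y]) < 0.
Proof.
move=> F0 Fa Ua ab; have [d d0 dP] := logder_near T F0 Fa Ua.
pose h := Num.min (d / 2) ((a - b) / 2).
have h0 : 0 < h by rewrite lt_min; apply/andP; split; lra.
have hd : h <= d / 2 by rewrite ge_min lexx.
have hb : h <= (a - b) / 2 by rewrite ge_min lexx orbT.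
exists (a - h); first by lra.
have := dP (a - h); rewrite addrAC subrr add0r normrN gtr0_norm //.
rewrite mulNr -mulrN pmulr_rgt0 // oppr_gt0.
by apply; [rewrite lt_eqF //|]; lra.
Qed.

Lemma wronskM p q : wronsk (p * q) = p ^+ 2 * wronsk q + q ^+ 2 * wronsk p.
Proof. by rewrite /wronsk !(derivM, derivD); ring. Qed.

Lemma wronskXsubCX a k :
  wronsk (('X - a%:P) ^+ k.+1) = - k.+1%:R *: ('X - a%:P) ^+ k.*2.
Proof.
elim: k => [|k IH].
  by rewrite expr1 expr0 /wronsk derivXsubC derivC mulr0 expr1n sub0r scaleN1r.
rewrite exprS wronskM IH -[X in wronsk X]expr1.
have -> : wronsk (('X - a%:P) ^+ 1) = -1.
  by rewrite expr1 /wronsk derivXsubC derivC mulr0 expr1n sub0r.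
rewrite doubleS -exprM mulnC mul2n doubleS.
rewrite -scalerAr -exprD add2n mulrN1 -[X in _ - X]scale1r -scaleNr -scalerDl.
by rewrite [in RHS]mulrSr opprD.
Qed.

(** Writing [F = (X - a) ^ k q] with [q a != 0], [wronsk F / F ^ 2] has leading
    part [- k / (y - a) ^ 2]. *)
Lemma wronsk_right F a b : F != 0 -> root F a -> a < b ->
  exists2 y, a < y < b & (wronsk F).[y] < 0.
Proof.
move=> F0 Fa ab; have [[|k] [q]] := multiplicity_XsubC F a; rewrite F0 /=.
  by move=> qa FE; move: Fa; rewrite FE mulr1 (negPf qa).
move=> qa FE.
pose H : {poly R} := k.+1%:R *: q ^+ 2 - ('X - a%:P) ^+ 2 * wronsk q.
have Ha : 0 < H.[a].
  have -> : H.[a] = k.+1%:R * q.[a] ^+ 2.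
    by rewrite /H !horner_rules subrr; ring.
  by rewrite mulr_gt0 ?ltr0n // exprn_even_gt0.
have [d d0 dP] := poly_pos_near Ha.
pose h := Num.min (d / 2) ((b - a) / 2).
have h0 : 0 < h by rewrite lt_min; apply/andP; split; lra.
have hd : h <= d / 2 by rewrite ge_min lexx.
have hb : h <= (b - a) / 2 by rewrite ge_min lexx orbT.
exists (a + h); first by lra.
have -> : wronsk F = - (('X - a%:P) ^+ k) ^+ 2 * H.
  rewrite FE wronskM wronskXsubCX /H -mul2n mulnC exprM -!mul_polyC polyCN [_ ^+ k.+1]exprSr.
  ring.
have := dP (a + h); rewrite addrAC subrr add0r gtr0_norm // => Hp.
rewrite hornerM hornerN !horner_exp hornerXsubC mulNr oppr_lt0 mulr_gt0 //.
  by rewrite addrAC subrr add0r !exprn_gt0.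
by apply: Hp; lra.
Qed.

(** The factor ['X^2] makes both products below have factors of degree at most
    [deg F], whatever that degree, including when [F''] vanishes. *)
Lemma wronsk_mulX2 F : 'X^2 * wronsk F = F * ('X^2 * F^`()^`()) - ('X * F^`()) ^+ 2.
Proof. by rewrite /wronsk; ring. Qed.

Lemma coefM_top (A B : {poly R}) m n : (size A <= m.+1)%N -> (size B <= n.+1)%N ->
  (A * B)`_(m + n) = A`_m * B`_n.
Proof.
move=> sA sB; rewrite coefM.
have mlt : (m < (m + n).+1)%N by rewrite ltnS leq_addr.
rewrite (bigD1 (Ordinal mlt)) //= addKn big1 ?addr0 // => i.
rewrite -val_eqE /= => im.
have [lt|] := ltnP m i; first by rewrite (nth_default _ (leq_trans sA lt)) mul0r.
move=> le; rewrite [B`__]nth_default ?mulr0 //; apply: leq_trans sB _.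
by rewrite ltn_subRL ltn_add2r ltn_neqAle im.
Qed.

(** The top coefficient is [n (n - 1) - n ^ 2 = - n] times the square of the
    leading coefficient of [F], where [n = deg F]. *)
Lemma wronsk_size F : (1 < size F)%N ->
  size (wronsk F) = ((size F).-1 * 2).-1 /\
  lead_coef (wronsk F) = - (size F).-1%:R * lead_coef F ^+ 2.
Proof.
move=> sF; set n := (size F).-1; have n0 : (0 < n)%N by rewrite /n; case: (size F) sF.
have sFn : size F = n.+1 by rewrite /n; case: (size F) sF.
have F0 : F != 0 by rewrite -size_poly_gt0 sFn.
have s1 : (size ('X^2 * F^`()^`())%R <= n.+1)%N.
  have [->|G0] := eqVneq (F^`()^`()) 0; first by rewrite mulr0 size_poly0.
  have G1 : F^`() != 0 by apply: contraNneq G0 => ->; rewrite deriv0.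
  rewrite mulrC size_mulXn // add2n.
  have := lt_size_deriv G1; have := lt_size_deriv F0; rewrite sFn.
  move=> h1 h2; exact: leq_trans h2 h1.
have s2 : (size ('X * F^`())%R <= n.+1)%N.
  rewrite mulrC.
  have [->|G1] := eqVneq (F^`()) 0; first by rewrite mul0r size_poly0.
  by rewrite size_mulX // -sFn; exact: lt_size_deriv.
have c : ('X^2 * wronsk F)`_(n + n) = - n%:R * lead_coef F ^+ 2.
  rewrite wronsk_mulX2 coefB !expr2 !coefM_top ?sFn // -expr2 coefXnM coefXM !coef_deriv.
  rewrite lead_coefE -/n.
  case: n n0 {s1 s2 sFn} => // -[|m] _ /=.
    by rewrite mulr0 sub0r mulr1n mulN1r.
  rewrite !subSS subn0 -mulrnA -[_ *+ (_ * _)]mulr_natr -[_ *+ m.+2]mulr_natr natrM.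
  by rewrite -[m.+2%:R]natr1; ring.
have l0 : - n%:R * lead_coef F ^+ 2 != 0.
  by rewrite mulNr oppr_eq0 mulf_neq0 ?expf_neq0 ?lead_coef_eq0 // pnatr_eq0 -lt0n.
have szM (A B : {poly R}) : (size A <= n.+1)%N -> (size B <= n.+1)%N ->
    (size (A * B)%R <= (n + n).+1)%N.
  move=> sA sB; apply: leq_trans (size_polyMleq A B) _.
  by rewrite -ltnS; case: (size A + size B)%N (leq_add sA sB) => //= ?; rewrite addnS addSn.
have s : size ('X^2 * wronsk F) = (n + n).+1.
  apply/eqP; rewrite eqn_leq; apply/andP; split.
    rewrite wronsk_mulX2; apply: leq_trans (size_polyD _ _) _.
    by rewrite geq_max size_polyN expr2 !szM // sFn.
  by rewrite ltnNge; apply/negP => /leq_sizeP /(_ _ (leqnn _)) /eqP; rewrite c (negPf l0).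
have W0 : wronsk F != 0.
  by apply/eqP => W0; move: s; rewrite W0 mulr0 size_poly0.
split.
  by move: s; rewrite mulrC size_mulXn // add2n => -[]; rewrite addnn -muln2 => <-.
by rewrite -c -(lead_coef_Mmonic _ (monicXn R 2)) [_ * 'X^2]mulrC lead_coefE s.
Qed.

Lemma wronsk_neq0 F : (1 < size F)%N -> wronsk F != 0.
Proof.
move=> sF; have [s _] := wronsk_size sF; rewrite -size_poly_gt0 s.
by case: (size F) sF => [|[|n]] //= _; rewrite mul2n.
Qed.

Lemma noroot_lt0 (I : interval R) F x y : {in I, forall t, ~~ root F t} ->
  x \in I -> y \in I -> F.[x] < 0 -> F.[y] < 0.
Proof.
by move=> nr xI yI; rewrite -!sgr_cp0 (polyrN0_itv nr yI xI).
Qed.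

Lemma ivt_itv (I : interval R) F x y : x \in I -> y \in I ->
  F.[x] * F.[y] < 0 -> exists2 d, d \in I & root F d.
Proof.
wlog xy : x y / x <= y => [H|] xI yI h.
  have [/H|/ltW/H] := leP x y; apply=> //; by rewrite mulrC.
have [d dxy dr] := poly_ivtoo xy h; exists d => //.
by move: d dxy {dr}; apply/subitvP; rewrite sub_oo_itv.
Qed.

(** The last zero of [F] before [x], if any. *)
Lemma root_below F x : F != 0 -> {in `]-oo, x[, forall t, ~~ root F t} \/
  exists e, [/\ e < x, root F e & {in `]e, x[, forall t, ~~ root F t}].
Proof.
move=> F0; pose a := Num.min (- cauchy_bound F) x - 1.
have acb : a < - cauchy_bound F.
  by rewrite /a ltrBlDr (le_lt_trans (y := - cauchy_bound F)) ?ge_min ?lexx // ltrDl.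
have ax : a < x.
  by rewrite /a ltrBlDr (le_lt_trans (y := x)) ?ge_min ?lexx ?orbT // ltrDl.
case: (prev_rootP F a x) => [/eqP|e _ Fe exy nr|c _ _ nr].
- by rewrite (negPf F0).
- right; exists e; split; [by rewrite (itvP exy)|exact/rootP|exact: nr].
- left=> t; rewrite in_itv /= => tx.
  have [ta|ta] := ltP a t; first by apply: nr; rewrite in_itv /= ta.
  by apply: (le_cauchy_bound F0); rewrite in_itv /= (le_trans ta (ltW acb)).
Qed.

Lemma root_last F r : F != 0 -> root F r ->
  exists2 e, root F e & {in `]e, +oo[, forall t, ~~ root F t}.
Proof.
move=> F0 Fr; case: (root_below (cauchy_bound F) F0) => [nr|[e [_ Fe nr]]].
  have := nr r; rewrite in_itv /= (root_cauchy_boundP F0 Fr) => /(_ isT).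
  by rewrite Fr.
exists e => // t; rewrite in_itv /= andbT => et.
have [ct|ct] := ltP t (cauchy_bound F); first by apply: nr; rewrite in_itv /= et.
by apply: (ge_cauchy_bound F0); rewrite in_itv /= ct.
Qed.

Lemma wronsk_minfty F : (1 < size F)%N ->
  exists b, forall y, y <= b -> (wronsk F).[y] < 0.
Proof.
move=> sF; exists (- cauchy_bound (wronsk F)) => y yb.
have := @sgp_minftyP _ _ _ (le_cauchy_bound (wronsk_neq0 sF)) y.
rewrite in_itv /= => /(_ yb); have [s l] := wronsk_size sF.
rewrite /sgp_minfty s l; have F0 : F != 0 by rewrite -size_poly_gt0 ltnW.
case: (size F) sF => [|[|n]] //= _.
rewrite muln2 -signr_odd odd_double expr0 mul1r.
have -> : Num.sg (- n.+1%:R * lead_coef F ^+ 2) = -1.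
  apply: ltr0_sg; rewrite mulNr oppr_lt0 mulr_gt0 ?ltr0n //.
  by rewrite exprn_even_gt0 //= lead_coef_eq0.
by move/eqP; rewrite sgr_cp0.
Qed.

End Rcf.

(** * One step of the induction: matching events *)

Section Step.
Variables (R : rcfType) (p : {poly R}) (s : R).
Let P := p^`() + s *: p.
Let W := wronsk p.
Let W1 := wronsk P.
Hypothesis size_p : (1 < size p)%N.
Hypothesis size_P : (1 < size P)%N.
Hypothesis P_pos : forall x, root W x -> ~~ root p x -> 0 <= P.[x] * p.[x].

Let p0 : p != 0. Proof. by rewrite -size_poly_gt0 ltnW. Qed.
Let P0 : P != 0. Proof. by rewrite -size_poly_gt0 ltnW. Qed.
Let W0 : W != 0. Proof. exact: wronsk_neq0. Qed.
Let PW0 : P * W != 0. Proof. exact: mulf_neq0. Qed.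
Let PpW0 : P * p * W != 0. Proof. by rewrite !mulf_neq0. Qed.

Lemma wronsk_shift : W = p * P^`() - p^`() * P.
Proof. by rewrite /W /P /wronsk !derivE -!mul_polyC; ring. Qed.

(** With [f = exp (s x) p] and [f' = exp (s x) P], this is the identity
    [(wronsk f / f')' = f (f'' / f')']. *)
Lemma wronsk_step : p * W1 = s *: (W * P) + W^`() * P - W * P^`().
Proof. by rewrite /W1 /W /P /wronsk expr2 !derivE -!mul_polyC; ring. Qed.

Lemma root_wronsk_root x : root W x -> root p x -> root P x.
Proof.
rewrite /root {1}/W /wronsk /P !(hornerD,hornerN,horner_exp,hornerM,hornerZ).
move=> /eqP h /eqP px; move: h; rewrite px mul0r sub0r mulr0 addr0 => /eqP.
by rewrite oppr_eq0 expf_eq0.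
Qed.

Lemma wronsk_root_pos x : root W x -> ~~ root P x -> 0 < P.[x] * p.[x].
Proof.
move=> Wx Px; have px : ~~ root p x by apply: contra Px; exact: root_wronsk_root.
by rewrite lt_neqAle P_pos // eq_sym mulf_neq0.
Qed.

Let U := P ^+ 2 * (p * P).
Let T := (s *: P ^+ 2 - P * P^`()) * (p * P).

(** The polynomials [U] and [T] turn [wronsk_step] into an instance of
    [logder_near] for [F = W]; the extra factor [p P] in both makes the result
    [W W1] times a square. *)
Let logder_wronsk y : W.[y] * (W^`().[y] * U.[y] + W.[y] * T.[y]) =
  (W.[y] * W1.[y]) * (P.[y] * p.[y]) ^+ 2.
Proof.
(* for abstract polynomials, as the rewriting rules would unfold [P] *)
have gen (w w1 q : {poly R}) : p * w1 = s *: (w * q) + w^`() * q - w * q^`() ->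
    w.[y] * (w^`().[y] * (q ^+ 2 * (p * q)).[y] +
      w.[y] * ((s *: q ^+ 2 - q * q^`()) * (p * q)).[y]) =
    (w.[y] * w1.[y]) * (q.[y] * p.[y]) ^+ 2.
  move=> /(congr1 (horner^~ y)).
  rewrite !(hornerD,hornerN,horner_exp,hornerM,hornerZ) => h.
  have -> : w.[y] * w1.[y] * (q.[y] * p.[y]) ^+ 2 =
    w.[y] * (p.[y] * w1.[y]) * (q.[y] ^+ 2 * p.[y]) by ring.
  by rewrite h; ring.
exact: gen wronsk_step.
Qed.

Let U_pos x : 0 < P.[x] * p.[x] -> 0 < U.[x].
Proof.
move=> h; have -> : U.[x] = P.[x] ^+ 2 * (P.[x] * p.[x]).
  (* for an abstract [q], as the rewriting rules would unfold [P] *)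
  have gen (q : {poly R}) : (q ^+ 2 * (p * q)).[x] = q.[x] ^+ 2 * (q.[x] * p.[x]).
    by rewrite hornerM [(p * q).[x]]hornerM horner_exp [p.[x] * _]mulrC.
  exact: gen.
rewrite mulr_gt0 // exprn_even_gt0 //=.
by apply/eqP => Px; move: h; rewrite Px mul0r ltxx.
Qed.

Lemma wronsk_step_right z b : root W z -> ~~ root P z -> z < b ->
  exists2 y, z < y < b & 0 < (W * W1).[y].
Proof.
move=> Wz Pz zb.
have [y yI] := logder_right T W0 Wz (U_pos (wronsk_root_pos Wz Pz)) zb.
rewrite logder_wronsk => h; exists y => //.
have sq_gt0 : 0 < (P.[y] * p.[y]) ^+ 2.
  by rewrite exprn_even_gt0 //=; apply/eqP => z0; move: h; rewrite z0 expr0n mulr0 ltxx.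
by move: h; rewrite pmulr_lgt0 // -hornerM.
Qed.

Lemma wronsk_step_left z b : root W z -> ~~ root P z -> b < z ->
  exists2 y, b < y < z & (W * W1).[y] < 0.
Proof.
move=> Wz Pz zb.
have [y yI] := logder_left T W0 Wz (U_pos (wronsk_root_pos Wz Pz)) zb.
rewrite logder_wronsk => h; exists y => //.
have sq_gt0 : 0 < (P.[y] * p.[y]) ^+ 2.
  by rewrite exprn_even_gt0 //=; apply/eqP => z0; move: h; rewrite z0 expr0n mulr0 ltxx.
by move: h; rewrite pmulr_llt0 // -hornerM.
Qed.

Lemma pole_right r b : root p r -> r < b ->
  exists2 y, r < y < b & 0 < (P * p).[y].
Proof.
move=> pr rb; have U1 : 0 < (1 : {poly R}).[r] by rewrite hornerC ltr01.
have [y yI h] := logder_right s%:P p0 pr U1 rb; exists y => //.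
rewrite hornerM mulrC /P hornerD hornerZ; move: h.
by rewrite !hornerC mulr1 [s * _]mulrC.
Qed.

Lemma pole_left r b : root p r -> b < r ->
  exists2 y, b < y < r & (P * p).[y] < 0.
Proof.
move=> pr rb; have U1 : 0 < (1 : {poly R}).[r] by rewrite hornerC ltr01.
have [y yI h] := logder_left s%:P p0 pr U1 rb; exists y => //.
rewrite hornerM mulrC /P hornerD hornerZ; move: h.
by rewrite !hornerC mulr1 [s * _]mulrC.
Qed.

(** The points to be matched.  At the critical points that are events, [p] does
    not vanish either, by [root_wronsk_root]. *)
Definition is_event x := root p x || (root W x && ~~ root P x).
(** The points where [p' / p] takes the value [- s]. *)
Definition is_level x := root P x && ~~ root p x.
(** The critical points of [P' / P]. *)
Definition is_step_crit x := root W1 x && ~~ root P x.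

(** The event [a] may be matched with a level point on its left, with no event
    in between; if [a] is the first event, with a level point after which there
    is no event (needed when [P / p < 0] near both infinities); if [a] is not a
    zero of [p], with a critical point of [P' / P] on its left, with no event
    of that kind in between.  The value [None] stands for a first event without
    partner, and is needed only when [deg P < deg p]. *)
Definition matched (a : R) (ob : option R) : Prop :=
  match ob with
  | None => forall x, is_event x -> a <= x
  | Some b =>
    [\/ [/\ is_level b, b < a & forall x, is_event x -> b < x -> a <= x],
        [/\ is_level b, forall x, is_event x -> x <= b & forall x, is_event x -> a <= x] |
        [/\ is_step_crit b, ~~ root p a, b < a &
            forall x, is_event x -> ~~ root p x -> b < x -> a <= x]]
  end.

Lemma matched_inj a a' ob : is_event a -> is_event a' ->
  matched a ob -> matched a' ob -> a = a'.
Proof.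
move=> Aa Aa'; case: ob => [b|] /=; last first.
  by move=> /(_ _ Aa') h /(_ _ Aa) h'; apply/eqP; rewrite eq_le h h'.
have CD : is_level b -> is_step_crit b -> False.
  by move=> /andP[h _] /andP[_]; rewrite h.
have eqa : a <= a' -> a' <= a -> a = a' by move=> *; apply/eqP; rewrite eq_le; apply/andP.
case=> [[Cb ba h]|[Cb h1 h2]|[Db pa ba h]] [[Cb' ba' h']|[Cb' h1' h2']|[Db' pa' ba' h']];
  try (by case: (CD)); try by (apply: eqa; auto).
  by have := h1' _ Aa; rewrite leNgt ba.
by have := h1 _ Aa'; rewrite leNgt ba'.
Qed.

(** If [P / p < 0] on an interval that starts at [e] and contains no zero of
    [P p W], then [e] can be neither a zero of [p] nor a critical point of
    [p' / p] outside the level points, as [P / p] would be positive just right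
    of [e]. *)
Lemma left_end_level e c y : root (P * p * W) e ->
  {in Interval (BRight e) c, forall t, ~~ root (P * p * W) t} ->
  y \in Interval (BRight e) c -> (P * p).[y] < 0 -> is_level e.
Proof.
move=> Fe nr yI y0.
have nr' : {in Interval (BRight e) c, forall t, ~~ root (P * p) t}.
  by move=> t /nr; apply: contra; rewrite [root (_ * W) t]rootM => ->.
have ey : e < y by move: yI; rewrite itv_boundlr => /andP[].
have sub t : e < t -> t <= y -> t \in Interval (BRight e) c.
  move=> et ty; move: yI; rewrite !itv_boundlr => /andP[_ yc].
  by rewrite bnd_simp et; apply: le_trans yc; rewrite bnd_simp.
have pe : ~~ root p e.
  apply/negP => pe; have [t /andP[et ty]] := pole_right pe ey.
  rewrite ltNge => /negP; apply; apply: ltW.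
  by apply: noroot_lt0 nr' yI (sub _ et (ltW ty)) y0.
rewrite /is_level pe andbT; apply: contraT => Pe.
have We : root W e by move: Fe; rewrite !rootM (negPf Pe) (negPf pe).
have := wronsk_root_pos We Pe; rewrite -hornerM.
rewrite ltNge => /negP; case; apply: ltW.
apply: (@noroot_lt0 _ `[e, y] _ y) => //; try by rewrite in_itv /= lexx ltW.
move=> t; rewrite in_itv /= => /andP[+ ty]; rewrite le_eqVlt => /predU1P[<-|et].
  by rewrite rootM negb_or Pe.
exact/nr'/sub.
Qed.

Lemma size_step : s != 0 -> size P = size p /\ lead_coef P = s * lead_coef p.
Proof.
move=> s0; have h : (size p^`() < size (s *: p))%N by rewrite size_scale // lt_size_deriv.
by rewrite /P addrC size_polyDl // lead_coefDl // size_scale // lead_coefZ.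
Qed.

Lemma pinfty_step : s != 0 -> sgp_pinfty (P * p) = Num.sg s.
Proof.
move=> s0; rewrite /sgp_pinfty lead_coefM (size_step s0).2 -mulrA -expr2 sgrM.
by rewrite [X in _ * X]gtr0_sg ?mulr1 // exprn_even_gt0 //= lead_coef_eq0.
Qed.

Lemma minfty_step : s != 0 -> sgp_minfty (P * p) = Num.sg s.
Proof.
move=> s0; rewrite -(pinfty_step s0) /sgp_minfty /sgp_pinfty size_mul //.
rewrite (size_step s0).1; case: (size p) size_p => // n _.
by rewrite addnn doubleS /= -signr_odd odd_double expr0 mul1r.
Qed.

Lemma event_root x : is_event x -> root (P * p * W) x.
Proof. by rewrite !rootM; case/orP=> [->|/andP[-> _]]; rewrite ?orbT. Qed.

(** When no zero of [P p W] precedes [r], the quotient [P / p] is negative near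
    minus infinity, where it tends to [s]; then [s <= 0], and for [s < 0] it is
    negative near plus infinity too, which yields a level point beyond all
    events. *)
Lemma exists_pole r : root p r ->
  (s = 0 /\ matched r None) \/ exists2 b, is_level b & matched r (Some b).
Proof.
move=> pr; have Fr : root (P * p * W) r by rewrite !rootM pr orbT.
case: (root_below r PpW0) => [nr|[e [er Fe nr]]]; last first.
  have [y yI y0] := pole_left pr er.
  have Ce := left_end_level Fe nr (y := y) yI y0.
  right; exists e => //; apply: Or31; split=> // x /event_root Fx ex.
  rewrite leNgt; apply: contraL Fx => xr; apply: nr.
  by rewrite in_itv /= ex.
have minr x : is_event x -> r <= x.
  by move/event_root => Fx; rewrite leNgt; apply: contraL Fx => xr; apply: nr.
have [s0|s0] := eqVneq s 0; first by left.
right; have nr' : {in `]-oo, r - 1], forall t, ~~ root (P * p) t}.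
  move=> t; rewrite in_itv /= => tr; have /nr : t \in `]-oo, r[.
    by rewrite in_itv /=; apply: le_lt_trans tr _; rewrite ltrBlDr ltrDl.
  by apply: contra; rewrite [root (_ * W) t]rootM => ->.
have [y /andP[_ yr] y0] : exists2 y, r - 1 < y < r & (P * p).[y] < 0.
  by apply: pole_left => //; rewrite ltrBlDr ltrDl.
have s_lt0 : s < 0.
  rewrite -sgr_cp0 -(minfty_step s0) -(@sgp_minftyP _ _ _ nr' (r - 1)) ?bound_in_itv //.
  rewrite sgr_cp0; apply: (@noroot_lt0 _ `]-oo, r[ _ y) => //.
    by move=> t /nr; apply: contra; rewrite [root (_ * W) t]rootM => ->.
  by rewrite in_itv /= ltrBlDr ltrDl.
have [e Fe nre] := root_last PpW0 Fr.
have e1 : e + 1 \in `]e, +oo[ by rewrite in_itv /= andbT ltrDl.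
have Ce : is_level e.
  apply: (left_end_level Fe nre e1); rewrite -sgr_cp0.
  rewrite (@sgp_pinftyP _ (e + 1)) ?bound_in_itv ?pinfty_step ?sgr_cp0 //.
  move=> t; rewrite in_itv /= andbT => et.
  have /nre : t \in `]e, +oo[.
    by rewrite in_itv /= andbT; apply: lt_le_trans et; rewrite ltrDl.
  by apply: contra; rewrite [root (_ * W) t]rootM => ->.
exists e => //; apply: Or32; split=> // x /event_root Fx.
by rewrite leNgt; apply: contraL Fx => ex; apply: nre; rewrite in_itv /= ex.
Qed.

(** On an interval ending at [z], free of zeroes of [P W], a point where
    [W W1 > 0] produces a zero of [W1], since [W W1 < 0] just left of [z]. *)
Lemma exists_crit_of_pos z c y : root W z -> ~~ root P z ->
  {in Interval c (BLeft z), forall t, ~~ root (P * W) t} ->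
  y \in Interval c (BLeft z) -> 0 < (W * W1).[y] ->
  exists2 b, is_level b || is_step_crit b & matched z (Some b).
Proof.
move=> Wz Pz nr yI y0.
have [cy yz] : (c <= BLeft y)%O /\ y < z.
  by move: yI; rewrite itv_boundlr => /andP[].
have [y' /andP[yy' y'z] y'0] := wronsk_step_left Wz Pz yz.
have y'I : y' \in Interval c (BLeft z).
  by rewrite itv_boundlr bnd_simp y'z andbT (le_trans cy) // bnd_simp ltW.
have [|d dI] := @ivt_itv _ _ (W * W1) y y' yI y'I; first by rewrite nmulr_llt0.
have := nr _ dI; rewrite !rootM negb_or => /andP[Pd Wd]; rewrite (negPf Wd) /= => W1d.
exists d; first by rewrite /is_step_crit W1d Pd orbT.
have [cd dz] : (c <= BLeft d)%O /\ d < z by move: dI; rewrite itv_boundlr => /andP[].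
apply: Or33; split=> //; first by rewrite /is_step_crit W1d.
  by apply: contra Pz => pz; apply: root_wronsk_root.
move=> x + px dx; rewrite /is_event (negPf px) /= => /andP[Wx _].
rewrite leNgt; apply/negP => xz; have : x \in Interval c (BLeft z).
  by rewrite itv_boundlr bnd_simp xz andbT (le_trans cd) // bnd_simp ltW.
by move/nr; rewrite rootM Wx orbT.
Qed.

Lemma exists_crit z : root W z -> ~~ root P z ->
  exists2 b, is_level b || is_step_crit b & matched z (Some b).
Proof.
move=> Wz Pz; have pz : ~~ root p z by apply: contra Pz; apply: root_wronsk_root.
case: (root_below z PW0) => [nr|[e [ez Fe nr]]].
  (* [W] and [W1] are both negative near minus infinity *)
  have [b bP] := wronsk_minfty size_p; have [b' b'P] := wronsk_minfty size_P.
  pose y := Num.min (Num.min b b') (z - 1).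
  have yz : y \in `]-oo, z[.
    rewrite in_itv /= (le_lt_trans (y := z - 1)) ?ge_min ?lexx ?orbT //.
    by rewrite ltrBlDr ltrDl.
  apply: (exists_crit_of_pos Wz Pz nr yz); rewrite hornerM nmulr_rgt0.
    by apply: b'P; rewrite !ge_min lexx ?orbT.
  by apply: bP; rewrite !ge_min lexx ?orbT.
have [Pe|Pe] := boolP (root P e); last first.
  have We : root W e by move: Fe; rewrite rootM (negPf Pe).
  have [y yI y0] := wronsk_step_right We Pe ez.
  exact: (exists_crit_of_pos Wz Pz nr (y := y)).
(* [W1 < 0] just right of the zero [e] of [P]: the sign of [W] decides *)
have [y yI y0] := wronsk_right P0 Pe ez.
have nrW : {in `]e, z[, forall t, ~~ root W t}.
  by move=> t /nr; apply: contra; rewrite rootM orbC => ->.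
have [Wy|Wy] := ltP W.[y] 0.
  by apply: (exists_crit_of_pos Wz Pz nr (y := y)) => //; rewrite hornerM nmulr_rgt0.
have noneg t : e < t < z -> ~ W.[t] < 0.
  by move=> tI /(noroot_lt0 nrW (y := y) tI yI); rewrite ltNge Wy.
have pe : ~~ root p e.
  by apply/negP => /(wronsk_right p0)/(_ ez)[t /noneg].
have Ce : is_level e by rewrite /is_level Pe.
exists e; first by rewrite Ce.
apply: Or31; split=> // x Ax ex; rewrite leNgt; apply/negP => xz.
case/orP: Ax => [px|/andP[Wx _]].
  have [t /andP[xt tz]] := wronsk_right p0 px xz.
  by apply: noneg; rewrite tz (lt_trans ex xt).
by have := nrW x; rewrite in_itv /= ex xz Wx => /(_ isT).
Qed.

End Step.

(** * Counting *)

(** A relation that is total and injective on [A] plays the role of an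
    injection from [A] to [B]. *)
Lemma leq_size_matching (T U : eqType) (A : seq T) (B : seq U) (rel : T -> U -> Prop) :
  uniq A -> (forall a, a \in A -> exists2 b, b \in B & rel a b) ->
  (forall a a' b, a \in A -> a' \in A -> rel a b -> rel a' b -> a = a') ->
  (size A <= size B)%N.
Proof.
elim: A B => [|a A IH] //= B /andP[aA uA] ex inj.
have [b bB ab] := ex a (mem_head _ _).
have B0 : (0 < size B)%N by case: B bB {ex}.
suff : (size A <= size (rem b B))%N by rewrite size_rem //; case: (size B) B0.
apply: IH => // [a' a'A|a1 a2 b' a1A a2A].
  have a'aA : a' \in a :: A by rewrite inE a'A orbT.
  have [b' b'B a'b'] := ex a' a'aA; exists b' => //; apply: rem_mem => //.
  apply: contraNneq aA => bb'; rewrite bb' in a'b'.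
  by rewrite (inj a a' b (mem_head _ _) a'aA ab a'b').
by apply: inj; rewrite inE ?a1A ?a2A orbT.
Qed.

Section Count.
Variables (R : rcfType) (p : {poly R}) (s : R).
Let P := p^`() + s *: p.
Let W := wronsk p.
Let W1 := wronsk P.
Hypothesis size_p : (1 < size p)%N.
Hypothesis size_P : (1 < size P)%N.
Hypothesis P_pos : forall x, root W x -> ~~ root p x -> 0 <= P.[x] * p.[x].
Variable t : seq R.
Hypothesis t_uniq : uniq t.
Hypothesis t_P : forall x, root P x -> x \in t.
Hypothesis t_W1 : forall x, root W1 x -> x \in t.

Let p0 : p != 0. Proof. by rewrite -size_poly_gt0 ltnW. Qed.
Let P0 : P != 0. Proof. by rewrite -size_poly_gt0 ltnW. Qed.

Lemma size_step_le : (size P <= size p)%N.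
Proof.
have [s0|s0] := eqVneq s 0; last by rewrite /P (size_step size_p s0).1.
by rewrite /P s0 scale0r addr0 ltnW // lt_size_deriv.
Qed.

Lemma exists_pole_count r : root p r ->
  exists2 ob, ob \in nseq (size p - size P) None ++ map Some (filter (is_level p s) t)
            & matched p s r ob.
Proof.
move=> pr; have [[s0 m]|[b Cb m]] := exists_pole size_p size_P P_pos pr.
  exists None => //; rewrite mem_cat mem_nseq eqxx andbT subn_gt0.
  by rewrite /P s0 scale0r addr0 lt_size_deriv.
exists (Some b) => //; rewrite mem_cat; apply/orP; right.
rewrite mem_map; last by move=> ? ? [].
by rewrite mem_filter Cb; apply: t_P; case/andP: Cb.
Qed.

Lemma count_pole :
  (count (root p) t <= size p - size P + count (is_level p s) t)%N.
Proof.
suff : (size (filter (root p) t) <=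
    size (nseq (size p - size P) None ++ map Some (filter (is_level p s) t)))%N.
  by rewrite size_cat size_nseq size_map !size_filter.
apply: (@leq_size_matching _ _ _ _ (matched p s)) => [|a|a a' b].
- exact: filter_uniq.
- by rewrite mem_filter => /andP[/exists_pole_count].
- rewrite !mem_filter => /andP[pa _] /andP[pa' _].
  by apply: matched_inj; rewrite /is_event ?pa ?pa'.
Qed.

Lemma count_event : (count (is_event p s) t <=
   size p - size P + (count (is_level p s) t + count (is_step_crit p s) t))%N.
Proof.
have -> : (count (is_level p s) t + count (is_step_crit p s) t =
           count (fun x => is_level p s x || is_step_crit p s x) t)%N.
  rewrite -count_predUI [X in (_ + X)%N](_ : _ = 0%N) ?addn0 //.
  rewrite -(count_pred0 t); apply: eq_count => x /=; rewrite /is_level /is_step_crit.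
  by case: (root _ x); rewrite ?andbF.
suff : (size (filter (is_event p s) t) <= size (nseq (size p - size P) None ++
    map Some (filter (fun x => is_level p s x || is_step_crit p s x) t)))%N.
  by rewrite size_cat size_nseq size_map !size_filter.
apply: (@leq_size_matching _ _ _ _ (matched p s)) => [|a|a a' b].
- exact: filter_uniq.
- rewrite mem_filter => /andP[/orP[/exists_pole_count [b b0 m]|/andP[Wa Pa]] _].
    exists b => //; move: b0; rewrite !mem_cat; case/orP=> [->|]; first by [].

    case/mapP=> c; rewrite mem_filter => /andP[Cc ct] ->; apply/orP; right.
    by rewrite map_f // mem_filter Cc.
  have [b b1 m] := exists_crit size_p size_P P_pos Wa Pa; exists (Some b) => //.
  rewrite mem_cat; apply/orP; right; rewrite map_f // mem_filter b1.
  by case/orP: b1 => /andP[? _]; [exact: t_P|exact: t_W1].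
- rewrite !mem_filter => /andP[Aa _] /andP[Aa' _]; exact: matched_inj.
Qed.

(** At a zero of [p], the multiplicity drops by at most one; at a level point,
    the multiplicity in [P] is at least one, and at least two when the point is
    also critical for [p' / p]. *)
Lemma mup_step x :
  (mup x p + is_level p s x + [&& root W x, root P x & ~~ root p x]
   <= mup x P + root p x)%N.
Proof.
have [px|px] := boolP (root p x).
  rewrite /is_level px !andbF !addn0 addn1.
  have : ('X - x%:P) ^+ (mup x p) %| p by rewrite -mup_geq.
  case: (mup x p) => [|m] dvd //; rewrite ltnS mup_geq // /P.
  apply: dvdp_add; last first.
    by rewrite -mul_polyC dvdp_mull // (dvdp_trans _ dvd) // exprS dvdp_mull.
  have /dvdpP[q ->] := dvd.
  rewrite derivM deriv_exp derivXsubC mul1r dvdp_add //.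
    by rewrite exprS mulrA dvdp_mull.
  by rewrite dvdp_mull // -mulr_natl dvdp_mull.
rewrite (mupNroot px) /is_level -/P (negPf px) !andbT add0n addn0.
have [Px|Px] := boolP (root P x); last by rewrite andbF.
rewrite !andbT; have [Wx|Wx] := boolP (root W x); last first.
  by rewrite addn0 -XsubC_dvd // dvdp_XsubCl.
rewrite mup_ge2P P0 Px /=; move: Wx.
rewrite /W (wronsk_shift p s) -/P /root hornerD hornerN !hornerM.
by rewrite (eqP Px) mulr0 subr0 mulf_eq0 => /orP[pz|//]; move: px; rewrite /root pz.
Qed.

End Count.

Lemma count_roots (R : rcfType) (F : {poly R}) (Q : pred R) (t : seq R) :
  F != 0 -> uniq t -> (forall x, root F x -> x \in t) ->
  count (fun x => root F x && Q x) t = count Q (rootsR F).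
Proof.
move=> F0 ut rt; rewrite -!size_filter; apply/perm_size/uniq_perm.
- exact: filter_uniq.
- exact/filter_uniq/uniq_roots.
move=> x; rewrite !mem_filter -(roots_on_rootsR F0) in_itv /=.
case Fx: (root F x); last by rewrite andbF.
by rewrite (rt _ Fx) !andbT.
Qed.

(** * Real critical points and non-real zeroes *)

Section Complex.
Variable R : realType.
Implicit Types p : {poly R}.

Lemma mup_cpoly p (x : R) : p != 0 -> mup (x%:C)%C (cpoly p) = mup x p.
Proof.
move=> p0; have c0 : cpoly p != 0 by rewrite map_poly_eq0.
have E n : (n <= mup (x%:C)%C (cpoly p))%N = (n <= mup x p)%N.
  rewrite !mup_geq // /cpoly -(dvdp_map (real_complex R)) rmorphXn /=.
  by rewrite map_polyXsubC.
by apply/eqP; rewrite eqn_leq -E leqnn E leqnn.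
Qed.

Lemma count_real (r : seq R[i]) (t : seq R) : uniq t ->
  (forall x : R, (x%:C)%C \in r -> x \in t) ->
  count (fun z => z \is Num.real) r = \sum_(x <- t) count_mem (x%:C)%C r.
Proof.
move=> ut; elim: r => [|z r IH] rt; first by rewrite big1_seq.
rewrite /= big_split /= -IH => [|x xr]; last by apply: rt; rewrite inE xr orbT.
congr (_ + _)%N; have [zr|zr] := boolP (z \is Num.real).
  have [x zx] := complex_realP _ zr; have xt : x \in t by apply: rt; rewrite zx mem_head.
  rewrite (big_rem x) //= zx eqxx big1_seq ?addn0 // => y /andP[_].
  rewrite mem_rem_uniq // inE => /andP[yx _].
  by rewrite (inj_eq (@complexI R)) eq_sym (negPf yx).
rewrite big1_seq // => x _; case: eqP => // zx.
by move: zr; rewrite zx complex_real eqxx.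
Qed.

(** The list [t] may contain points other than zeroes of [p], so that two
    polynomials can be compared over the same list. *)
Lemma ZC_mup p (t : seq R) : p != 0 -> uniq t -> (forall x, root p x -> x \in t) ->
  (ZC p + \sum_(x <- t) mup x p = (size p).-1)%N.
Proof.
move=> p0 ut rt; rewrite /ZC; case: closed_field_poly_normal => r /= E.
have c0 : cpoly p != 0 by rewrite map_poly_eq0.
have l0 : lead_coef (cpoly p) != 0 by rewrite lead_coef_eq0.
have cm z : mup z (cpoly p) = count_mem z r.
  rewrite E -mul_polyC mupMr ?mu_prod_XsubC //.
  by rewrite rootC.
have -> : (size p).-1 = size r.
  by rewrite -(size_map_poly (real_complex R)) -/(cpoly p) E size_scale // size_prod_XsubC.
rewrite -(count_predC (fun z => z \is Num.real) r) addnC; congr (_ + _)%N.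
rewrite (count_real ut) => [|x xr].
  by apply: eq_bigr => x _; rewrite -cm mup_cpoly.
by apply: rt; rewrite -dvdp_XsubCl XsubC_dvd // -mup_cpoly // cm -has_count has_pred1.
Qed.

(** The number of distinct real critical points of [p' / p]. *)
Definition crit_count p := count (fun x => ~~ root p x) (rootsR (wronsk p)).

Lemma seq_max (T : eqType) (f : T -> R) (l : seq T) : l != [::] ->
  exists2 m, m \in l & forall x, x \in l -> f x <= f m.
Proof.
elim: l => // a [_ _|b l /(_ isT)[m ml mP] _].
  by exists a; rewrite ?mem_head // => x; rewrite inE => /eqP ->.
have [am|ma] := leP (f a) (f m).
  exists m; first by rewrite inE ml orbT.
  by move=> x; rewrite inE => /predU1P[->|/mP].
exists a; first exact: mem_head.
by move=> x; rewrite inE => /predU1P[->|/mP/le_trans]; last apply; rewrite ?lexx ?ltW.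
Qed.

(** This is the Hawaii conjecture of Craven, Csordas and Smith, first proved by
    Tyaglov, with distinct critical points counted. *)
Theorem crit_count_le_ZC p : (1 < size p)%N -> (crit_count p <= ZC p)%N.
Proof.
elim/ltn_ind: (ZC p) {-2}p (leqnn (ZC p)) => n IH {}p pn sp.
have p0 : p != 0 by rewrite -size_poly_gt0 ltnW.
have W0 := wronsk_neq0 sp.
rewrite /crit_count -size_filter; set l := filter _ _.
have [->//|l0] := eqVneq l [::].
have lP x : (x \in l) = root (wronsk p) x && ~~ root p x.
  by rewrite mem_filter -(roots_on_rootsR W0) in_itv /= andbC.
(* the largest value [s] of [- p' / p] at the critical points, attained at [m] *)
have [m ml mP] := seq_max (fun x => - (p^`().[x] / p.[x])) l0.
pose s := - (p^`().[m] / p.[m]); pose P := p^`() + s *: p.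
have /andP[Wm pm] : root (wronsk p) m && ~~ root p m by rewrite -lP.
have Pm : root P m.
  by rewrite /root /P hornerD hornerZ /s mulNr divfK // subrr.
have P_pos x : root (wronsk p) x -> ~~ root p x -> 0 <= P.[x] * p.[x].
  move=> Wx px; have /mP : x \in l by rewrite lP Wx.
  rewrite -/s => sx; rewrite /P hornerD hornerZ.
  have -> : (p^`().[x] + s * p.[x]) * p.[x] = (s - - (p^`().[x] / p.[x])) * p.[x] ^+ 2.
    by move: px; rewrite /root => px; field.
  by rewrite mulr_ge0 ?subr_ge0 // sqr_ge0.
(* [wronsk p] is a nonzero constant for [p] of degree one *)
have sp3 : (2 < size p)%N.
  rewrite ltnNge; apply/negP => sp2; have sp2' : size p = 2 by apply/eqP; rewrite eqn_leq sp2.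
  have [sW _] := wronsk_size sp; move: sW; rewrite sp2' => /eqP/size_poly1P[c c0 Wc].
  by move: Wm; rewrite Wc rootC (negPf c0).
have sP : (1 < size P)%N.
  have [s0|s0] := eqVneq s 0; last by rewrite (size_step sp s0).1.
  by rewrite /P s0 scale0r addr0 size_deriv; case: (size p) sp3 => [|[|[|]]].
have P0 : P != 0 by rewrite -size_poly_gt0 ltnW.
have W10 := wronsk_neq0 sP.
pose F := p * P * wronsk p * wronsk P.
have F0 : F != 0 by rewrite !mulf_neq0.
pose t := rootsR F.
have ut : uniq t by exact: uniq_roots.
have tF x : (x \in t) = root F x by rewrite -(roots_on_rootsR F0) in_itv.
have tp x : root p x -> x \in t by rewrite tF !rootM => ->.
have tP x : root P x -> x \in t by rewrite tF !rootM => ->; rewrite orbT.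
have tW x : root (wronsk p) x -> x \in t by rewrite tF !rootM => ->; rewrite !orbT.
have tW1 x : root (wronsk P) x -> x \in t by rewrite tF !rootM => ->; rewrite !orbT.
have ep := ZC_mup p0 ut tp; have eP := ZC_mup P0 ut tP.
have h1 := count_pole sp sP P_pos ut tP.
have h2 := count_event sp sP P_pos ut tP tW1.
have h3 : (\sum_(x <- t) mup x p + count (is_level p s) t +
   count (fun x => [&& root (wronsk p) x, root P x & ~~ root p x]) t <=
   \sum_(x <- t) mup x P + count (root p) t)%N.
  have cnt (Q : pred R) : count Q t = (\sum_(x <- t) Q x)%N.
    by rewrite -sum1_count big_mkcond; apply: eq_bigr => x _; case: (Q x).
  by rewrite !cnt -!big_split /=; apply: leq_sum => x _; exact: mup_step.
have h4 : (count (is_event p s) t = count (root p) t +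
    count (fun x => root (wronsk p) x && ~~ root P x) t)%N.
  rewrite -count_predUI [X in (_ + X)%N](_ : _ = 0%N) ?addn0 //.
  rewrite -(count_pred0 t); apply: eq_count => x /=; apply/negbTE/negP.
  by case/and3P=> px Wx; rewrite (root_wronsk_root s Wx px).
have h5 : (size l = count (fun x => root (wronsk p) x && ~~ root P x) t +
   count (fun x => [&& root (wronsk p) x, root P x & ~~ root p x]) t)%N.
  rewrite size_filter -(count_roots _ W0 ut tW) -count_predUI.
  rewrite [X in (_ + X)%N](_ : _ = 0%N) ?addn0.
    apply: eq_count => x /=; have := @root_wronsk_root R p s x; rewrite -/P.
    by case: (root (wronsk p) x) => //; case: (root p x); case: (root P x) => // /(_ isT isT).
  rewrite -(count_pred0 t); apply: eq_count => x /=.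
  by case: (root P x); rewrite ?andbF.
have h6 : count (is_step_crit p s) t = crit_count P := count_roots _ W10 ut tW1.
have h7 : (0 < count (fun x => [&& root (wronsk p) x, root P x & ~~ root p x]) t)%N.
  by rewrite -has_count; apply/hasP; exists m; rewrite ?tW ?Wm ?Pm.
have h8 : (size P <= size p)%N := size_step_le s sp.
have := IH (ZC P) _ P (leqnn _) sP; rewrite -h6; move: h1 h2 h3 ep eP h8 sP pn h7.
rewrite -/P h4 h5.
move: (count (is_level p s) t) (count (is_step_crit p s) t) (count (root p) t) => C D S.
move: (count _ t) (count _ t) => a b.
move: (\sum_(x <- t) mup x p)%N (\sum_(x <- t) mup x P)%N => A B.
move: (size p) (size P) (ZC p) (ZC P) => d e f g.
move=> h1 h2 h3 ep eP h8 sP pn h7 /(_ _)/wrap[]; lia.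
Qed.

End Complex.

Local Open Scope classical_set_scope.
Local Open Scope fset_scope.

Lemma card_fset_set_le (T : choiceType) (M : set T) (s : seq T) :
  (forall x, M x -> x \in s) -> finite_set M /\ (#|` fset_set M| <= size s)%N.
Proof.
move=> Ms; have fM : finite_set M.
  by apply: sub_finite_set (finite_seq s) => x /Ms.
split=> //; apply: uniq_leq_size (fset_uniq _) _ => x.
by rewrite in_fset_set // => /set_mem/Ms.
Qed.

Lemma multiple_zero_wronsk (R : realType) (p : {poly R}) z :
  multiple_zeros_psigma p z -> root (cpoly (wronsk p)) z.
Proof.
case=> s; rewrite /multiple_zero mup_ge2P /psigma => /and3P[_ P0 P'0].
rewrite (wronsk_shift p s) /cpoly rmorphB !rmorphM /= -!deriv_map -/(cpoly _).
rewrite /root hornerD hornerN !hornerM.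
by rewrite (eqP P'0) [(cpoly (_ + _)).[z]](eqP P0) !mulr0 subr0.
Qed.

Lemma multiple_zero_neq0 (R : realType) (p : {poly R}) z : p != 0 ->
  (forall z : R[i], root (cpoly p) z -> simple_zero (cpoly p) z) ->
  multiple_zeros_psigma p z -> ~~ root (cpoly p) z.
Proof.
move=> p0 p_simple [s]; rewrite /multiple_zero mup_ge2P /psigma => /and3P[_ P0 _].
apply/negP => pz; have := p_simple _ pz; rewrite /simple_zero => mz.
have : (2 <= mup z (cpoly p))%N; last by rewrite mz.
rewrite mup_ge2P pz map_poly_eq0 p0 /=; move: P0.
rewrite /cpoly rmorphD /= map_polyZ /= -deriv_map -/(cpoly p) /root hornerD hornerZ.
by rewrite (eqP pz) mulr0 addr0.
Qed.

Theorem corollary3p2 (R : realType) (p : {poly R})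
    (p_nonconstant : (1 < size p)%N)
    (p_simple : forall z : R[i], root (cpoly p) z -> simple_zero (cpoly p) z) :
  let M := multiple_zeros_psigma p in
  [/\ finite_set M,
      (#|` fset_set M| <= 2 * (size p).-1 - 2)%N
    & (#|` fset_set (M `&` [set lambda : R[i] | lambda \is Num.real])%classic|
         <= ZC p)%N].
Proof.
move=> M.
have p0 : p != 0 by rewrite -size_poly_gt0 ltnW.
have W0 := wronsk_neq0 p_nonconstant; have [sW _] := wronsk_size p_nonconstant.
have cW0 : cpoly (wronsk p) != 0 by rewrite map_poly_eq0.
have [r E] := closed_field_poly_normal (cpoly (wronsk p)).
have lc : lead_coef (cpoly (wronsk p)) != 0 by rewrite lead_coef_eq0.
have [fM cM] : finite_set M /\ (#|` fset_set M| <= size r)%N.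
  apply: card_fset_set_le => z /multiple_zero_wronsk.
  by rewrite E rootZ // root_prod_XsubC.
split=> //.
  move: cM; suff -> : size r = (2 * (size p).-1 - 2)%N by [].
  have : size (cpoly (wronsk p)) = size (wronsk p) by rewrite size_map_poly.
   rewrite E size_scale // size_prod_XsubC sW; move: p_nonconstant; move: (size p) (size r) => a b.
  by lia.
apply: leq_trans (crit_count_le_ZC p_nonconstant).
rewrite /crit_count -size_filter -(size_map (real_complex R)).
refine (proj2 (card_fset_set_le _)) => z [Mz /complex_realP[x zx]].
have := multiple_zero_wronsk Mz; have := multiple_zero_neq0 p0 p_simple Mz.
rewrite zx /cpoly !fmorph_root => px Wx.
apply: map_f; rewrite mem_filter px -(roots_on_rootsR W0) in_itv /=; exact: Wx.
Qed.
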